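(* Let $G$ be a Hausdorff ample groupoid and $R$ a commutative ring with $1$. (1) If $G$ is topologically transitive and there is a dense subset $D\subseteq G^{(0)}$ such that $RG_d^d$ is prime for every $d\in D$, then $A_R(G)$ is prime. (2) If there is a dense subset $D\subseteq G^{(0)}$ such that $RG_d^d$ is semiprime for every $d\in D$, then $A_R(G)$ is semiprime.
   Context: For a groupoid $G$ with unit space $G^{(0)}$, $\boldsymbol{s}(x)=x^{-1}x$, $\boldsymbol{r}(x)=xx^{-1}$, $G_u=\boldsymbol{s}^{-1}(u)$, and $G_u^u$ is the isotropy group at the unit $u$. An ample groupoid is a topological groupoid in which $\boldsymbol{s}$ is a local homeomorphism and $G^{(0)}$ is locally compact, totally disconnected and Hausdorff. The Steinberg algebra $A_R(G)$ is the $R$-module of locally constant, compactly supported functions $f:G\to R$ with convolution $f*g(x)=\sum_{y\in G_{\boldsymbol{s}(x)}}f(xy^{-1})g(y)$. $RG_u^u$ is the group $R$-algebra of $G_u^u$. $G$ is topologically transitive if for every pair of nonempty open subsets $U,V\subseteq G^{(0)}$ the set $\boldsymbol{r}^{-1}(U)\cap\boldsymbol{s}^{-1}(V)$ is nonempty. A ring $A$ (not necessarily unital) is prime if $IJ=0$ implies $I=0$ or $J=0$ for all two-sided ideals $I,J$ of $A$, and semiprime if $I^2=0$ implies $I=0$ for all two-sided ideals $I$ of $A$. *)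

(* Defs.v *)
From HB Require Import structures.
From mathcomp Require Import all_boot all_order all_algebra.
From mathcomp Require Import all_classical topology.

Set Implicit Arguments.
Unset Strict Implicit.
Unset Printing Implicit Defensive.

Import GRing.Theory.

Local Open Scope classical_set_scope.
Local Open Scope ring_scope.

(* A possibly non-unital ring is given here by an additive group [V], a product
   [mul] on [V], and the subset [A] of [V] which carries the ring. *)

Section PrimeRings.
Variables (V : zmodType) (mul : V -> V -> V) (A : set V).
Implicit Types I J : set V.

Definition two_sided_ideal I :=
  [/\ I `<=` A,
      I 0,
      forall x y, I x -> I y -> I (x - y) &
      forall a x, A a -> I x -> I (mul a x) /\ I (mul x a)].

Definition ideal_mul I J : set V :=
  [set z | exists (n : nat) (x y : 'I_n -> V),
     (forall i, I (x i) /\ J (y i)) /\ z = \sum_(i < n) mul (x i) (y i)].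

Definition prime_ring :=
  forall I J, two_sided_ideal I -> two_sided_ideal J ->
    ideal_mul I J = [set 0] -> I = [set 0] \/ J = [set 0].

Definition semiprime_ring :=
  forall I, two_sided_ideal I -> ideal_mul I I = [set 0] -> I = [set 0].

End PrimeRings.

Section GroupAlgebra.
Variables (R : comPzRingType) (H : groupType).

Definition group_algebra : set (H -> R) :=
  [set f | finite_set [set x | f x != 0]].

Definition group_algebra_mul (f g : H -> R) : H -> R :=
  fun x => \sum_(y \in [set: H]) f (x * y^-1)%g * g y.

End GroupAlgebra.

(* [gcomp] is the set of composable pairs; [gmul] is a total function whose
   values outside of [gcomp] are irrelevant. *)

HB.mixin Record isGroupoid G := {
  gcomp : set (G * G);
  gmul : G -> G -> G;
  ginv : G -> G;
  ginvK : forall x, ginv (ginv x) = x;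
  gmulA : forall x y z, gcomp (x, y) -> gcomp (y, z) ->
    [/\ gcomp (gmul x y, z), gcomp (x, gmul y z) &
        gmul (gmul x y) z = gmul x (gmul y z)];
  gcompVg : forall x, gcomp (ginv x, x);
  gmulKg : forall x y, gcomp (x, y) -> gmul (ginv x) (gmul x y) = y;
  gmulgK : forall x y, gcomp (x, y) -> gmul (gmul x y) (ginv y) = x
}.

#[short(type="groupoidType")]
HB.structure Definition Groupoid := {G of isGroupoid G & Choice G}.

Arguments gmulA {_ x y z}.
Arguments gmulKg {_ x y}.
Arguments gmulgK {_ x y}.

Section GroupoidTheory.
Variable G : groupoidType.
Implicit Types x y z : G.

Definition unit_space : set G := range (fun x => gmul (ginv x) x).

Lemma gcompgV x : gcomp (x, ginv x).
Proof. by rewrite -{1}(ginvK x); exact: gcompVg. Qed.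

Lemma src_subproof x : gmul (ginv x) x \in unit_space.
Proof. by apply/mem_set; exists x. Qed.

Lemma rng_subproof x : gmul x (ginv x) \in unit_space.
Proof. by apply/mem_set; exists (ginv x) => //; rewrite ginvK. Qed.

Definition src x : unit_space := SigSub (src_subproof x).
Definition rng x : unit_space := SigSub (rng_subproof x).

Lemma rngV x : rng (ginv x) = src x.
Proof. by apply: val_inj; rewrite /= ginvK. Qed.

Lemma srcV x : src (ginv x) = rng x.
Proof. by apply: val_inj; rewrite /= ginvK. Qed.

Lemma gmulg_src x : gmul x (val (src x)) = x.
Proof. by have /= := gmulKg (gcompVg x); rewrite ginvK. Qed.

Lemma gmul_rngg x : gmul (val (rng x)) x = x.
Proof. by have /= := gmulgK (gcompgV x); rewrite ginvK. Qed.

Lemma gcompP x y : gcomp (x, y) <-> src x = rng y.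
Proof.
split=> [xy|e].
  apply: val_inj => /=.
  have [xxy _ xxyE] := gmulA (gcompVg x) xy.
  by have := gmulgK xxy; rewrite xxyE gmulKg.
have [_ xx _] := gmulA (gcompgV x) (gcompVg x).
have [yy _ _] := gmulA (gcompgV y) (gcompVg y).
have e' : gmul (ginv x) x = gmul y (ginv y) := congr1 val e.
have xx' : gcomp (x, gmul y (ginv y)) by rewrite -e'.
have [+ _ _] := gmulA xx' yy.
by rewrite -e' (gmulg_src x).
Qed.

Lemma srcM x y : gcomp (x, y) -> src (gmul x y) = src y.
Proof.
by move=> xy; have [+ _ _] := gmulA xy (gcompgV y); rewrite gcompP rngV.
Qed.

Lemma rngM x y : gcomp (x, y) -> rng (gmul x y) = rng x.
Proof.
by move=> xy; have [_ + _] := gmulA (gcompVg x) xy; rewrite gcompP srcV.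
Qed.

Lemma src_unit (u : unit_space) : src (val u) = u.
Proof.
case: u => u uU; have [x _ xu] := set_mem uU; apply: val_inj; rewrite /= -xu.
exact: (congr1 val (srcM (gcompVg x))).
Qed.

Lemma rng_unit (u : unit_space) : rng (val u) = u.
Proof.
case: u => u uU; have [x _ xu] := set_mem uU; apply: val_inj; rewrite /= -xu.
by have := congr1 val (rngM (gcompVg x)); rewrite rngV.
Qed.

End GroupoidTheory.

Arguments unit_space G : clear implicits.

Section Isotropy.
Variables (G : groupoidType) (u : unit_space G).

Definition isotropy : set G := [set x | src x = u /\ rng x = u].

Definition isotropy_group : Type := isotropy.

HB.instance Definition _ := Choice.on isotropy_group.

Implicit Types x y z : isotropy_group.

Let srcE x : src (val x) = u. Proof. by case: (set_mem (valP x)). Qed.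
Let rngE x : rng (val x) = u. Proof. by case: (set_mem (valP x)). Qed.

Let compE x y : gcomp (val x, val y).
Proof. by rewrite gcompP srcE rngE. Qed.

Lemma isotropy_one_subproof : val u \in isotropy.
Proof. by apply/mem_set; split; [exact: src_unit|exact: rng_unit]. Qed.

Lemma isotropy_inv_subproof x : ginv (val x) \in isotropy.
Proof. by apply/mem_set; split; rewrite ?srcV ?rngV ?srcE ?rngE. Qed.

Lemma isotropy_mul_subproof x y : gmul (val x) (val y) \in isotropy.
Proof.
apply/mem_set; have xy := compE x y.
by split; [rewrite srcM// srcE|rewrite rngM// rngE].
Qed.

Definition isotropy_one : isotropy_group := SigSub isotropy_one_subproof.
Definition isotropy_inv x : isotropy_group :=
  SigSub (isotropy_inv_subproof x).
Definition isotropy_mul x y : isotropy_group :=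
  SigSub (isotropy_mul_subproof x y).

Lemma isotropy_mulA : associative isotropy_mul.
Proof.
move=> x y z; apply: val_inj => /=.
by have [_ _ ->] := gmulA (compE x y) (compE y z).
Qed.

Lemma isotropy_mul1 : left_id isotropy_one isotropy_mul.
Proof. by move=> x; apply: val_inj; rewrite /= -(rngE x) gmul_rngg. Qed.

Lemma isotropy_mulr1 : right_id isotropy_one isotropy_mul.
Proof. by move=> x; apply: val_inj; rewrite /= -(srcE x) gmulg_src. Qed.

Lemma isotropy_mulV : left_inverse isotropy_one isotropy_inv isotropy_mul.
Proof. by move=> x; apply: val_inj; rewrite /= -(srcE x). Qed.

Lemma isotropy_mulrV : right_inverse isotropy_one isotropy_inv isotropy_mul.
Proof. by move=> x; apply: val_inj; rewrite /= -(rngE x). Qed.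

HB.instance Definition _ := isGroup.Build isotropy_group
  isotropy_mulA isotropy_mul1 isotropy_mulr1 isotropy_mulV isotropy_mulrV.

End Isotropy.

HB.mixin Record Groupoid_isTopological G of Groupoid G & Topological G := {
  gmul_continuous :
    {within (gcomp : set (G * G)), continuous (fun p : G * G => gmul p.1 p.2)};
  ginv_continuous : continuous (ginv : G -> G)
}.

#[short(type="topologicalGroupoidType")]
HB.structure Definition TopologicalGroupoid :=
  {G of Groupoid_isTopological G & Groupoid G & Topological G}.

Definition local_homeomorphism (X Y : topologicalType) (f : X -> Y) :=
  forall x, exists U : set X,
    [/\ open U, U x, open (f @` U), {within U, continuous f} &
        exists g : Y -> X,
          {in U, cancel f g} /\ {within f @` U, continuous g}].

(* The topology on the type [unit_space G] is the one induced by [G]. *)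
Definition ample (G : topologicalGroupoidType) :=
  [/\ local_homeomorphism (@src G),
      locally_compact [set: unit_space G],
      totally_disconnected [set: unit_space G] &
      hausdorff_space (unit_space G)].

Definition topologically_transitive (G : topologicalGroupoidType) :=
  forall U V : set (unit_space G), open U -> open V -> U !=set0 -> V !=set0 ->
    (@rng G @^-1` U) `&` (@src G @^-1` V) !=set0.

Section SteinbergAlgebra.
Variables (R : comPzRingType) (G : topologicalGroupoidType).

Definition locally_constant (f : G -> R) :=
  forall x, \forall y \near x, f y = f x.

Definition compactly_supported (f : G -> R) :=
  compact (closure [set x | f x != 0]).

Definition steinberg_algebra : set (G -> R) :=
  [set f | locally_constant f /\ compactly_supported f].

Definition convolution (f g : G -> R) : G -> R :=
  fun x => \sum_(y \in [set y | src y = src x]) f (gmul x (ginv y)) * g y.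

End SteinbergAlgebra.

(* Main.v *)
(* For an ideal [I] of the Steinberg algebra and a unit [d], the restrictions
   to the isotropy group at [d] of the functions in [I] form an ideal [I_d] of
   the group algebra: elements of the group algebra lift to combinations of
   indicators of compact open bisections. Multiplying in the middle by the
   indicator of a small bisection around [d] shows that [IJ = 0] implies
   [I_d J_d = 0]. Moreover [I_d] is nonzero as soon as some [f] in [I] does not
   vanish at some [z] with source [d], and the set of such units [d] is open
   and invariant, so it meets the dense set [D]; in the transitive case the
   sets attached to two nonzero ideals have a common point of [D]. *)

Require Import Defs.
From mathcomp Require Import all_boot all_order all_algebra.
From mathcomp Require Import finmap all_classical topology.

Set Implicit Arguments.
Unset Strict Implicit.
Unset Printing Implicit Defensive.

Import GRing.Theory.

Local Open Scope classical_set_scope.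
Local Open Scope ring_scope.

(** * Compact open neighbourhoods in totally disconnected Hausdorff spaces *)

Section CompactOpenBasis.
Variable X : topologicalType.
Implicit Types (x : X) (A C K U V W : set X) (Q : set (set X)).

(** Otherwise the traces on [K] of the members of [Q] generate a proper filter. Its cluster point in
    [K] lies in every closed member of [Q], against [sepQ]. *)
Lemma compact_avoid_directed K Q :
    compact K -> Q !=set0 -> (forall A, Q A -> closed A) ->
    (forall A B, Q A -> Q B -> exists2 C, Q C & C `<=` A `&` B) ->
    (forall p, K p -> exists2 A, Q A & ~ A p) ->
  exists2 A, Q A & A `&` K = set0.
Proof.
move=> cK [A0 QA0] clQ dirQ sepQ; apply: contrapT => nex.
pose F := filter_from Q (fun A => A `&` K).
have FF : ProperFilter F.
  apply: filter_from_proper => [|A QA].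
    apply: filter_from_filter; first by exists A0.
    move=> A B QA QB; have [C QC sC] := dirQ _ _ QA QB.
    by exists C => // y [/sC[Ay By] Ky].
  by apply/set0P/eqP => AK0; apply: nex; exists A.
have FK : F K by exists A0 => // y [].
have [p [Kp]] := cK F FF FK; rewrite clusterE => clp.
have [A QA nAp] := sepQ p Kp; apply: nAp.
by apply: (clQ A QA); apply: clp; exists A => // y [].
Qed.

Hypothesis hX : hausdorff_space X.

Lemma hausdorff_compact_sep_point x K : compact K -> ~ K x ->
  exists U, [/\ open U, U x & closure U `&` K = set0].
Proof.
move=> cK nKx.
pose Q := [set A : set X | exists U, [/\ open U, U x & A = closure U]].
have [||||_ [U [oU Ux ->]] UK] := @compact_avoid_directed K Q cK.
- by exists (closure setT), setT; split=> //; exact: openT.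
- by move=> _ [U [_ _ ->]]; exact: closed_closure.
- move=> A B [U [oU Ux ->]] [V [oV Vx ->]].
  exists (closure (U `&` V)); last exact: closureI.
  by exists (U `&` V); split=> //; exact: openI.
- move=> p Kp; apply: contrapT => nsep; apply: nKx.
  suff -> : x = p by [].
  apply: hX => A B.
  rewrite nbhsE => -[U [oU Ux] UA] Bp.
  have clUp : closure U p.
    by apply: contrapT => nU; apply: nsep; exists (closure U) => //; exists U.
  by have [z [Uz Bz]] := clUp B Bp; exists z; split=> //; exact: UA.
- by exists U.
Qed.

(** The closures of the open sets containing [K] form a directed family of closed sets, and one of
    them avoids [L] once each point of [L] is avoided. *)
Lemma hausdorff_compact_sep K L : compact K -> compact L -> K `&` L = set0 ->
  exists U V, [/\ open U, open V, K `<=` U, L `<=` V & U `&` V = set0].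
Proof.
move=> cK cL KL.
pose Q := [set A : set X | exists U, [/\ open U, K `<=` U & A = closure U]].
have [||||_ [U [oU KU ->]] UL] := @compact_avoid_directed L Q cL.
- by exists (closure setT), setT; split=> //; exact: openT.
- by move=> _ [U [_ _ ->]]; exact: closed_closure.
- move=> A B [U [oU KU ->]] [V [oV KV ->]].
  exists (closure (U `&` V)); last exact: closureI.
  exists (U `&` V); split=> //; first exact: openI.
  by move=> y Ky; split; [exact: KU|exact: KV].
- move=> p Lp.
  have nKp : ~ K p by move=> Kp; rewrite -[False]/(set0 p) -KL.
  have [U [oU Up UK]] := hausdorff_compact_sep_point cK nKp.
  (* The complement of [closure U] is open and contains [K]; its closure misses the open set [U],
     hence [p]. *)
  exists (closure (~` closure U)).
    exists (~` closure U); split=> //.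
      by rewrite openC; exact: closed_closure.
    by move=> y Ky clUy; rewrite -[False]/(set0 y) -UK.
  move=> /(_ U (open_nbhs_nbhs (conj oU Up)))[z [ncl Uz]]; apply: ncl.
  exact: subset_closure.
- exists U, (~` closure U); split=> //.
  + by rewrite openC; exact: closed_closure.
  + by move=> y Ly clUy; rewrite -[False]/(set0 y) -UL.
  + by apply/disjoints_subset; rewrite setCK; exact: subset_closure.
Qed.

(** For closed [C] these are the clopen subsets of the subspace [C] that contain [x], expressed by
    closed sets of [X]. *)
Let relclopen C x :=
  [set A : set X | [/\ A `<=` C, closed A, closed (C `\` A) & A x]].

(* The quasi-component of [x] in a compact set is connected, as disjoint
   compact sets can be separated by open sets. *)
Lemma compact_relclopen_sub C x W : compact C -> C x -> open W ->
    totally_disconnected [set: X] -> W x ->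
  exists2 A, relclopen C x A & A `<=` W.
Proof.
move=> cC Cx oW tdX Wx; have clC := compact_closed hX cC.
have QC : relclopen C x C by split=> //; rewrite setDv; exact: closed0.
pose Z := \bigcap_(A in relclopen C x) A.
have clZ : closed Z by apply: closed_bigI => A [].
have ZC : Z `<=` C by move=> y; apply.
have Zx : Z x by move=> A [].
have dirQ A B : relclopen C x A -> relclopen C x B ->
    exists2 D, relclopen C x D & D `<=` A `&` B.
  move=> [sAC clA clCA Ax] [sBC clB clCB Bx].
  exists (A `&` B) => //; split=> //.
  - by move=> y [/sAC].
  - exact: closedI.
  - by rewrite setDIr; exact: closedU.
(* Compactness of [C] minus [V]: a directed family whose intersection lies in [V] has a member
   inside [V]. *)
have shrink V : open V -> Z `<=` V -> exists2 A, relclopen C x A & A `<=` V.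
  move=> oV ZV.
  have [|||||A QA AV] := @compact_avoid_directed (C `\` V) (relclopen C x).
  - by rewrite setDE; apply: compact_closedI => //; exact: open_closedC.
  - by exists C.
  - by move=> A [].
  - exact: dirQ.
  - move=> p [Cp nVp]; apply: contrapT => nex; apply/nVp/ZV => A QA.
    by apply: contrapT => nAp; apply: nex; exists A.
  - exists A => // y Ay; apply: contrapT => nVy.
    rewrite -[False]/(set0 y) -AV; split=> //; split=> //.
    by case: QA => sAC _ _ _; exact: sAC.
(* A connected [Z] reduces to the point [x], which lies in [W]. *)
apply: (shrink) => //; suff cZ : connected Z.
  move=> y Zy; have : connected_component [set: X] x y.
    by exists Z => //; split.
  by rewrite tdX // => ->.
apply: contrapT => /connectedPn[E [E0 ZE [sep1 sep2]]].
have clE b : closed (E b).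
  move=> y cly; have Zy : Z y.
    apply: clZ; apply: (closure_subset _ cly); rewrite ZE.
    by case: b {cly} => z; [right|left].
  move: Zy; rewrite ZE; case: b cly => cly [] // Ey; exfalso.
    by rewrite -[False]/(set0 y) -sep2.
  by rewrite -[False]/(set0 y) -sep1.
have cE b : compact (E b).
  apply: (subclosed_compact (clE b) cC) => y Ey; apply: ZC.
  by rewrite ZE; case: b Ey; [right|left].
have {sep1 sep2} disj b : E b `&` E (~~ b) = set0.
  have d : E false `&` E true = set0.
    by rewrite -sep1 -(closure_id _).1.
  by case: b => //=; rewrite setIC.
have [b Ebx] : exists b, E b x.
  by move: Zx; rewrite ZE => -[]; [exists false|exists true].
have [U [V [oU oV EU EV UV]]] :=
  hausdorff_compact_sep (cE b) (cE (~~ b)) (disj b).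
have [A [sAC clA clCA Ax] AUV] : exists2 A, relclopen C x A & A `<=` U `|` V.
  apply: shrink; first exact: openU.
  move=> y; rewrite ZE; case: b {Ebx disj} EU EV => /= EU EV [] Ey;
    by [left; exact: EU|right; exact: EV|left; exact: EV|right; exact: EV].
(* Removing an open set keeps a set closed, so this identity makes [A] cut by [U] relatively
   clopen. *)
have AU : A `&` U = A `\` V.
  apply/seteqP; split=> y [Ay] => [Uy|nVy]; split=> //.
    by move=> Vy; rewrite -[False]/(set0 y) -UV.
  by case: (AUV y Ay).
have QAU : relclopen C x (A `&` U).
  split; [by move=> y [/sAC]| | |by split=> //; exact: EU].
    by rewrite AU setDE; apply: closedI => //; exact: open_closedC.
  rewrite setDIr setDE; apply: closedU => //; apply: closedI => //.
  exact: open_closedC.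
(* A point of the other half of [Z] would lie in every relatively clopen set around [x], hence in
   both [U] and [V]. *)
have [y Ey] := E0 (~~ b).
have Zy : Z y by rewrite ZE; case: (~~ b) Ey; [right|left].
have [_ Uy] := Zy _ QAU.
by rewrite -[False]/(set0 y) -UV; split=> //; exact: EV.
Qed.

(** A relatively clopen subset of a compact neighbourhood [C] is open in [X] as soon as it lies in
    the interior of [C]. *)
Lemma compact_open_basis x W :
    locally_compact [set: X] -> totally_disconnected [set: X] ->
    open W -> W x ->
  exists B, [/\ open B, compact B, B x & B `<=` W].
Proof.
move=> lcX tdX oW Wx; have [C + [cC _]] := lcX x I.
rewrite withinET => nbC.
have [||||A [sAC clA clCA Ax] AW] :=
    @compact_relclopen_sub C x (W `&` C°) cC.
- exact: nbhs_singleton.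
- by apply: openI => //; exact: open_interior.
- by [].
- by split.
exists A; split=> //; last by move=> y /AW[].
- suff -> : A = C° `&` ~` (C `\` A).
    by apply: openI; [exact: open_interior|rewrite openC].
  apply/seteqP; split=> [y Ay|y [/interior_subset Cy nCA]].
    by split; [case: (AW y Ay)|case].
  by apply: contrapT => nAy; apply: nCA.
- exact: (subclosed_compact clA cC).
Qed.

End CompactOpenBasis.

(** * Local homeomorphisms: compact open charts and finite fibres *)

Section LocalHomeomorphisms.
Variables (X Y : topologicalType) (f : X -> Y).
Hypothesis fh : local_homeomorphism f.
Implicit Types (x : X) (U W : set X).

Lemma local_homeomorphism_continuous : continuous f.
Proof.
move=> x; have [U [oU Ux _ + _]] := fh x.
by rewrite continuous_open_subspace// => /(_ x (mem_set Ux)).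
Qed.

Lemma local_homeomorphism_open W : open W -> open (f @` W).
Proof.
move=> oW; rewrite openE => _ [x Wx <-].
have [U [oU Ux ofU _ [g [gK]]]] := fh x.
rewrite continuous_open_subspace// => gc.
have fUx : (f @` U) (f x) by exists x.
have nW : nbhs (f x) (g @^-1` W).
  apply: (gc _ (mem_set fUx)); rewrite gK; last exact: mem_set.
  exact: open_nbhs_nbhs.
apply: filterS (filterI nW (open_nbhs_nbhs (conj ofU fUx))).
move=> y [/= Wgy [u Uu uy]]; exists u => //.
by move: Wgy; rewrite -uy gK//; exact: mem_set.
Qed.

Lemma local_homeomorphism_basis x W :
    (forall (y : Y) V, open V -> V y ->
      exists K, [/\ open K, compact K, K y & K `<=` V]) ->
    open W -> W x ->
  exists B, [/\ open B, compact B, B x, B `<=` W & {in B &, injective f}].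
Proof.
move=> basisY oW Wx; have [U [oU Ux ofU _ [g [gK gc]]]] := fh x.
have [||K [oK cK Kx KV]] := basisY (f x) (f @` (W `&` U)).
- by apply: local_homeomorphism_open; exact: openI.
- by exists x.
have gKP y : K y -> [/\ W (g y), U (g y) & f (g y) = y].
  by move=> /KV[u [Wu Uu] <-]; rewrite gK; [split|exact: mem_set].
have fI : {in U &, injective f} by move=> y z Uy Uz e; rewrite -(gK y)// e gK.
(* The image form gives compactness, the preimage form openness. *)
have KU : g @` K = U `&` f @^-1` K.
  apply/seteqP; split=> [_ [y Ky <-]|u [Uu Ku]].
    by have [_ Ug e] := gKP y Ky; split=> //=; rewrite e.
  by exists (f u) => //; rewrite gK//; exact: mem_set.
exists (g @` K); split.
- rewrite KU; apply: openI => //.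
  by have /continuousP fc := local_homeomorphism_continuous; exact: fc.
- apply: continuous_compact => //; apply: continuous_subspaceW gc.
  by move=> y /gKP[_ Ug <-]; exists (g y).
- by rewrite KU.
- by move=> _ [y /gKP[Wg _ _] <-].
- move=> y z; rewrite KU => /set_mem[Uy _] /set_mem[Uz _].
  by apply: fI; exact: mem_set.
Qed.

(** A chart domain meets a fibre in at most one point. The closed sets whose complement meets the
    fibre finitely are thus a directed family avoiding each point of [K], and one of them avoids all
    of [K]. *)
Lemma local_homeomorphism_finite_fiber K y :
  compact K -> finite_set (K `&` f @^-1` [set y]).
Proof.
move=> cK.
pose Q := [set A : set X | closed A /\ finite_set (~` A `&` f @^-1` [set y])].
have [||||A [_ finA] AK] := @compact_avoid_directed _ K Q cK.
- exists setT; split; first exact: closedT.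
  by rewrite setCT set0I; exact: finite_set0.
- by move=> A [].
- move=> A B [clA finA] [clB finB]; exists (A `&` B) => //; split.
    exact: closedI.
  by rewrite setCI setIUl finite_setU.
- move=> p Kp; have [U [oU Up _ _ [g [gK _]]]] := fh p.
  exists (~` U); last by move=> /(_ Up).
  split; first by rewrite closedC.
  rewrite setCK; apply: (@sub_finite_set _ _ [set g y]) => [w [Uw /= fw]|].
    by rewrite -fw gK//; exact: mem_set.
  exact: finite_set1.
- apply: sub_finite_set finA => w [Kw fw]; split=> // Aw.
  by rewrite -[False]/(set0 w) -AK.
Qed.

End LocalHomeomorphisms.

(** * Cancellation rules for quotients in a groupoid *)

Section GroupoidDivision.
Variable G : groupoidType.
Implicit Types x y z : G.

Lemma gcomp_div x y : src x = src y -> gcomp (x, ginv y).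
Proof. by rewrite gcompP rngV. Qed.

Lemma src_div x y : src x = src y -> src (gmul x (ginv y)) = rng y.
Proof. by move=> /gcomp_div/srcM ->; rewrite srcV. Qed.

Lemma rng_div x y : src x = src y -> rng (gmul x (ginv y)) = rng x.
Proof. by move=> /gcomp_div/rngM. Qed.

Lemma gmul_divK x y : src x = src y -> gmul (gmul x (ginv y)) y = x.
Proof. by move=> /gcomp_div/gmulgK; rewrite ginvK. Qed.

Lemma gmul_ldivK x y : rng x = rng y -> gmul x (gmul (ginv x) y) = y.
Proof.
move=> xy; have : gcomp (ginv x, y) by rewrite gcompP srcV.
by move=> /gmulKg; rewrite ginvK.
Qed.

Lemma src_ldiv x y : rng x = rng y -> src (gmul (ginv x) y) = src y.
Proof. by move=> xy; rewrite srcM// gcompP srcV. Qed.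

Lemma rng_ldiv x y : rng x = rng y -> rng (gmul (ginv x) y) = src x.
Proof. by move=> xy; rewrite rngM ?rngV// gcompP srcV. Qed.

Lemma gdiv_unit x u : src x = u -> gmul x (ginv (val u)) = x.
Proof.
move=> xu; have xu' : gcomp (x, val u) by rewrite gcompP rng_unit.
by rewrite -[X in gmul X _](gmulg_src x) xu gmulgK.
Qed.

Lemma gdiv_eq x y z : src x = src y -> gmul x (ginv y) = z ->
  y = gmul (ginv z) x.
Proof.
move=> xy e; have zy : gcomp (z, y) by rewrite gcompP -e src_div.
by rewrite -(gmul_divK xy) e gmulKg.
Qed.

Lemma gdiv_ldiv x y : rng x = rng y ->
  gmul y (ginv (gmul (ginv x) y)) = x.
Proof.
move=> xy; rewrite -[X in gmul X _](gmul_ldivK xy) gmulgK//.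
by rewrite gcompP rng_ldiv.
Qed.

End GroupoidDivision.

(** * Convolution with scaled indicators of bisections *)

Section WeightedIndicator.
Variables (R : comPzRingType) (G : topologicalGroupoidType).
Implicit Types (B : set G) (f : G -> R) (x y b : G) (c : R).

Definition indic_scale c B : G -> R := fun x => if x \in B then c else 0.

Lemma indic_scaleT c B x : B x -> indic_scale c B x = c.
Proof. by move=> Bx; rewrite /indic_scale mem_set. Qed.

Lemma indic_scaleF c B x : ~ B x -> indic_scale c B x = 0.
Proof. by move=> Bx; rewrite /indic_scale memNset. Qed.

Lemma indic_scale_steinberg c B : hausdorff_space G -> open B -> compact B ->
  steinberg_algebra (indic_scale c B).
Proof.
move=> hG oB cB; have clB := compact_closed hG cB; split=> [x|].
  have [Bx|nBx] := pselect (B x).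
    apply: filterS (open_nbhs_nbhs (conj oB Bx)) => y By.
    by rewrite !indic_scaleT.
  have oCB : open (~` B) by rewrite openC.
  apply: filterS (open_nbhs_nbhs (conj oCB nBx)) => y nBy.
  by rewrite !indic_scaleF.
apply: (subclosed_compact _ cB); first exact: closed_closure.
rewrite [X in _ `<=` X](closure_id _).1//; apply: closure_subset => x /= /eqP.
by apply: contra_notP => /indic_scaleF.
Qed.

(** Injectivity of the source on [B] leaves only the term [y = b] in the sum. *)
Lemma convolution_indicr f c B x b : {in B &, injective (@src G)} ->
  B b -> src b = src x ->
  convolution f (indic_scale c B) x = f (gmul x (ginv b)) * c.
Proof.
move=> injB Bb bx; rewrite /convolution -(fsbig_widen [set b]).
- by rewrite fsbig_set1 indic_scaleT.
- by move=> _ ->.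
- move=> y [/= yx yb]; rewrite indic_scaleF ?mulr0// => By.
  by apply: yb; apply: injB; rewrite ?inE// bx.
Qed.

Lemma convolution_indicr0 f c B x : (forall b, B b -> src b <> src x) ->
  convolution f (indic_scale c B) x = 0.
Proof.
move=> nB; rewrite /convolution fsbig1// => y yx.
by rewrite indic_scaleF ?mulr0// => /nB.
Qed.

(** The quotient of [x] by [y] has range [rng x], so it lies in [B] only if it equals [b]; this
    determines [y]. *)
Lemma convolution_indicl f c B x b : {in B &, injective (@rng G)} ->
  B b -> rng b = rng x ->
  convolution (indic_scale c B) f x = c * f (gmul (ginv b) x).
Proof.
move=> injB Bb bx; rewrite /convolution -(fsbig_widen [set gmul (ginv b) x]).
- by rewrite fsbig_set1 gdiv_ldiv// indic_scaleT.
- by move=> _ ->; exact: src_ldiv.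
- move=> y [/= yx yb]; rewrite indic_scaleF ?mul0r// => Bxy.
  apply: yb; apply: gdiv_eq => //; apply: injB; rewrite ?inE//.
  by rewrite rng_div.
Qed.

End WeightedIndicator.

(** * Compact open bisections and supports in an ample groupoid *)

Section AmpleGroupoid.
Variable G : topologicalGroupoidType.
Hypothesis aG : ample G.
Implicit Types (x : G) (W : set G) (u : unit_space G).

Let srch : local_homeomorphism (@src G). Proof. by case: aG. Qed.

Lemma ample_src_continuous : continuous (@src G).
Proof. exact: local_homeomorphism_continuous srch. Qed.

(** Inversion exchanges source and range: [B] is chosen so small that its inverse lies in a set [V]
    around [ginv x] on which the source is injective. *)
Lemma ample_bisection_basis x W : open W -> W x ->
  exists B, [/\ open B /\ compact B, B x, B `<=` W,
    {in B &, injective (@src G)} & {in B &, injective (@rng G)}].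
Proof.
move=> oW Wx; have [_ lcU tdU hU] := aG.
have basisU u V := @compact_open_basis _ hU u V lcU tdU.
have [V [oV _ Vx _ injV]] :=
  local_homeomorphism_basis srch basisU openT (Logic.I : setT (ginv x)).
have [||B [oB cB Bx BW injB]] :=
    @local_homeomorphism_basis _ _ _ srch x (W `&` ginv @^-1` V) basisU.
- apply: openI => //; have /continuousP := @ginv_continuous G; exact.
- by [].
exists B; split=> //; first by move=> y /BW[].
move=> y z /set_mem/BW[_ Vy] /set_mem/BW[_ Vz] e.
by rewrite -(ginvK y) (injV (ginv y) (ginv z)) ?inE ?srcV// ginvK.
Qed.

Variable R : comPzRingType.
Implicit Types f : G -> R.

Lemma steinberg_finite_fiber f u : steinberg_algebra f ->
  finite_set [set x | src x = u /\ f x != 0].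
Proof.
move=> [_ cf].
apply: sub_finite_set (local_homeomorphism_finite_fiber srch u cf).
by move=> x [xu fx]; split=> //; exact: subset_closure.
Qed.

Lemma steinberg_support_open f : steinberg_algebra f ->
  open [set x | f x != 0].
Proof.
move=> [lf _]; rewrite openE => x /= fx; apply: filterS (lf x) => y /= ->.
exact: fx.
Qed.

End AmpleGroupoid.

(** * Sums in ideals and vanishing ideal products *)

Section Ideals.
Variables (V : zmodType) (mul : V -> V -> V) (A I : set V).
Hypothesis idI : two_sided_ideal mul A I.

Lemma two_sided_ideal_sum (T : Type) (s : seq T) (F : T -> V) :
  (forall t, I (F t)) -> I (\sum_(t <- s) F t).
Proof.
case: idI => _ I0 IB _ IF; apply: big_ind => // x y Ix Iy.
by rewrite -[y]opprK; apply: (IB) => //; rewrite -sub0r; exact: IB.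
Qed.

End Ideals.

Lemma ideal_mul_eq0 (V : zmodType) (mul : V -> V -> V) (I J : set V) :
  I 0 -> J 0 ->
  ideal_mul mul I J = [set 0] <-> (forall x y, I x -> J y -> mul x y = 0).
Proof.
move=> I0 J0; split=> [IJ x y Ix Jy|IJ].
  rewrite -[mul x y = 0]/([set 0] (mul x y)) -IJ.
  by exists 1%N, (fun=> x), (fun=> y); split=> //; rewrite big_ord1.
apply/seteqP; split=> [_ [n [x [y [xy ->]]]]|_ ->].
  by apply: big1 => i _; have [Ix Jy] := xy i; exact: IJ.
exists 0%N, (fun=> 0), (fun=> 0); split=> [[]//|].
by rewrite big_ord0.
Qed.

Lemma neq_set0_ex (V : zmodType) (I : set V) :
  I 0 -> I <> [set 0] -> exists2 x, I x & x <> 0.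
Proof.
move=> I0 nI; apply: contrapT => nex; apply: nI.
apply/seteqP; split=> [x Ix|_ ->//].
by apply: contrapT => x0; apply: nex; exists x.
Qed.

(** * Group algebra products as finite sums over one support *)

Section GroupAlgebraSums.
Variables (R : comPzRingType) (H : groupType).
Implicit Types (a h : H -> R) (x : H).

Lemma group_algebra_mulEr h a x : group_algebra a ->
  group_algebra_mul h a x =
  \sum_(z <- fset_set [set z | a z != 0]) h (x * z^-1)%g * a z.
Proof.
move=> fa; rewrite /group_algebra_mul -(fsbig_widen [set z | a z != 0])//.
  exact: fsbig_finite.
by move=> z [_ /= /negP/negPn/eqP->]; rewrite mulr0.
Qed.

Lemma group_algebra_mulEl a h x : group_algebra a ->
  group_algebra_mul a h x =
  \sum_(z <- fset_set [set z | a z != 0]) a z * h (z^-1 * x)%g.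
Proof.
move=> fa; rewrite /group_algebra_mul.
(* The substitution turns the argument of [a] into [z], so that the sum can be cut to the support of
   [a]. *)
rewrite (reindex_fsbig (fun z => z^-1 * x)%g [set: H]); last first.
  split=> //.
    by move=> y z _ _ /mulIg/invg_inj.
  by move=> y _; exists (x * y^-1)%g => //; rewrite invgF mulgVK.
rewrite -(fsbig_widen [set z | a z != 0])//; last first.
  by move=> z [_ /= /negP/negPn/eqP az]; rewrite invgM invgK mulVKg az mul0r.
rewrite fsbig_finite//; apply: eq_bigr => z _.
by rewrite invgM invgK mulVKg.
Qed.

End GroupAlgebraSums.

(** * Restriction of ideals to an isotropy group *)

Section IdealRestriction.
Variables (G : topologicalGroupoidType) (R : comPzRingType).
Hypotheses (aG : ample G) (hG : hausdorff_space G).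
Variable d : unit_space G.
Implicit Types (f g : G -> R) (I J : set (G -> R)) (x y : isotropy_group d).

Local Notation A := (@steinberg_algebra R G).
Local Notation conv := (@convolution R G).
Local Notation RGd := (@group_algebra R (isotropy_group d)).
Local Notation gconv := (@group_algebra_mul R (isotropy_group d)).

Definition isotropy_res f : isotropy_group d -> R := fun x => f (val x).

Lemma src_isotropy x : src (val x) = d.
Proof. by case: (set_mem (valP x)). Qed.

Lemma rng_isotropy x : rng (val x) = d.
Proof. by case: (set_mem (valP x)). Qed.

Lemma isotropy_res_group_algebra f : A f -> RGd (isotropy_res f).
Proof.
move=> Af; have fin := steinberg_finite_fiber aG d Af.
rewrite /group_algebra /=.
have -> : [set x | isotropy_res f x != 0] =
    val @^-1` [set z | src z = d /\ f z != 0].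
  apply/seteqP; split=> [x fx|x []//]; split=> //; exact: src_isotropy.
apply: finite_preimage => // x y _ _; exact: val_inj.
Qed.

Lemma isotropy_res_ideal I : two_sided_ideal conv A I ->
  two_sided_ideal gconv RGd (isotropy_res @` I).
Proof.
move=> idI; have [IA I0 IB IM] := idI; split.
- by move=> _ [f /IA Af <-]; exact: isotropy_res_group_algebra.
- by exists 0.
- by move=> _ _ [f If <-] [g Ig <-]; exists (f - g) => //; exact: IB.
move=> a _ fa [f If <-].
have /choice[B HB] x := ample_bisection_basis aG openT (Logic.I : setT (val x)).
(* All isotropy elements at [d] share one source, so [B x] contains only [x] among them; summing [e]
   over the support of [a] lifts [a]. *)
pose e x := indic_scale (a x) (B x).
have Ae x : A (e x).
  by have [[oB cB] _ _ _ _] := HB x; exact: indic_scale_steinberg.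
split.
- exists (\sum_(z <- fset_set [set z | a z != 0]) conv (e z) f).
    by apply: (two_sided_ideal_sum idI) => z; exact: (IM _ _ (Ae z) If).1.
  apply/funext => x; rewrite group_algebra_mulEl// /isotropy_res fct_sumE.
  apply: eq_bigr => z _; have [_ Bz _ _ injB] := HB z.
  by rewrite (convolution_indicl _ _ injB Bz)// !rng_isotropy.
- exists (\sum_(z <- fset_set [set z | a z != 0]) conv f (e z)).
    by apply: (two_sided_ideal_sum idI) => z; exact: (IM _ _ (Ae z) If).2.
  apply/funext => x; rewrite group_algebra_mulEr// /isotropy_res fct_sumE.
  apply: eq_bigr => z _; have [_ Bz _ injB _] := HB z.
  by rewrite (convolution_indicr _ _ injB Bz)// !src_isotropy.
Qed.

(* With [e] the indicator of a small bisection around [d], the terms of the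
   convolution passing through a unit other than [d] vanish. *)
Lemma isotropy_res_mul f g : A f -> A g -> exists2 e, A e &
  isotropy_res (conv (conv f e) g) = gconv (isotropy_res f) (isotropy_res g).
Proof.
move=> Af Ag; have fin := steinberg_finite_fiber aG d Ag.
(* The finitely many units other than [d] through which the product could pass. Being finite, [T] is
   closed, so [B] can be chosen with sources off [T]. *)
pose T := @rng G @` [set y | src y = d /\ g y != 0] `\ d.
have clT : closed T.
  have [_ _ _ hU] := aG.
  apply: (accessible_finite_set_closed.1 (hausdorff_accessible hU)).
  by apply: finite_setD; exact: finite_image.
have oW : open (@src G @^-1` ~` T).
  have /continuousP := ample_src_continuous aG; apply.
  by rewrite openC.
have Wd : (@src G @^-1` ~` T) (val d) by rewrite /= src_unit => -[_]; apply.
have [B [[oB cB] Bd BW injB _]] := ample_bisection_basis aG oW Wd.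
exists (indic_scale 1 B); first exact: indic_scale_steinberg.
apply/funext => x; rewrite /isotropy_res /group_algebra_mul.
(* For [y] in the isotropy group, the middle factor contributes the unit [d]. For any other [y] with
   [g y] nonzero, [rng y] is in [T] and no element of [B] has this source. *)
rewrite {1}/convolution src_isotropy -(fsbig_widen (isotropy d)).
- rewrite (reindex_fsbig val [set: isotropy_group d]); last first.
    split.
    + by move=> y _; split; [exact: src_isotropy|exact: rng_isotropy].
    + by move=> y z _ _; exact: val_inj.
    + by move=> y yd; exists (SigSub (mem_set yd)).
  apply: eq_fsbigr => y _; congr (_ * _).
  have xy : src (val x) = src (val y) by rewrite !src_isotropy.
  have sxy : src (gmul (val x) (ginv (val y))) = d.
    by rewrite src_div// rng_isotropy.
  by rewrite (convolution_indicr _ _ injB Bd) ?src_unit// mulr1 gdiv_unit.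
- by move=> y [].
- move=> y [/= yd nyd]; have [->|gy] := eqVneq (g y) 0; first by rewrite mulr0.
  rewrite convolution_indicr0 ?mul0r// => b /BW /= nTb.
  rewrite src_div ?src_isotropy// => e; apply: nTb; rewrite e.
  split; first by exists y.
  by move=> yd'; apply: nyd; split.
Qed.

Lemma isotropy_res_ideal_mul I J :
  two_sided_ideal conv A I -> two_sided_ideal conv A J ->
  ideal_mul conv I J = [set 0] ->
  ideal_mul gconv (isotropy_res @` I) (isotropy_res @` J) = [set 0].
Proof.
move=> idI idJ; have [IA I0 _ IM] := idI; have [JA J0 _ _] := idJ.
have [_ I0' _ _] := isotropy_res_ideal idI.
have [_ J0' _ _] := isotropy_res_ideal idJ.
rewrite !ideal_mul_eq0// => IJ _ _ [f If <-] [g Jg <-].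
have [e Ae <-] := isotropy_res_mul (IA _ If) (JA _ Jg).
by rewrite IJ//; exact: (IM _ _ Ae If).2.
Qed.

(** Left multiplication by the indicator of a bisection around [ginv z] moves the value [f z] to the
    unit [d]. *)
Lemma isotropy_res_ideal_neq0 I f z : two_sided_ideal conv A I ->
  I f -> src z = d -> f z <> 0 -> isotropy_res @` I <> [set 0].
Proof.
move=> idI If zd fz0; have [_ _ _ IM] := idI.
have [B [[oB cB] Bz _ _ injB]] :=
  ample_bisection_basis aG openT (Logic.I : setT (ginv z)).
have Ae : A (indic_scale 1 B) by exact: indic_scale_steinberg.
move=> I0; apply: fz0.
have : (isotropy_res @` I) (isotropy_res (conv (indic_scale 1 B) f)).
  by exists (conv (indic_scale 1 B) f) => //; exact: (IM _ _ Ae If).1.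
rewrite I0 => /(congr1 (@^~ (isotropy_one d))); rewrite /isotropy_res /=.
rewrite (convolution_indicl _ _ injB Bz) ?rngV ?rng_unit// mul1r ginvK -zd.
by rewrite gmulg_src.
Qed.

End IdealRestriction.

(** * The open invariant set of units attached to an ideal *)

Section SupportUnits.
Variables (G : topologicalGroupoidType) (R : comPzRingType).
Hypotheses (aG : ample G) (hG : hausdorff_space G).
Implicit Types I : set (G -> R).

Local Notation A := (@steinberg_algebra R G).
Local Notation conv := (@convolution R G).

Definition support_units I : set (unit_space G) :=
  [set u | exists f z, [/\ I f, src z = u & f z <> 0]].

(** Supports of locally constant functions are open, and the source map is open. *)
Lemma support_units_open I : I `<=` A -> open (support_units I).
Proof.
move=> IA; have -> : support_units I =
    \bigcup_(f in I) (@src G @` [set z | f z != 0]).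
  apply/seteqP; split=> [u [f [z [If zu /eqP fz]]]|u [f If [z /= /eqP fz zu]]].
    by exists f => //; exists z.
  by exists f, z.
apply: bigcup_open => f /IA Af; have [srch _ _ _] := aG.
apply: local_homeomorphism_open srch _ _; exact: steinberg_support_open.
Qed.

Lemma support_units_neq0 I : I 0 -> I <> [set 0] -> support_units I !=set0.
Proof.
move=> I0 /(neq_set0_ex I0)[f If f0].
have [z fz] : exists z, f z <> 0.
  apply: contrapT => nex; apply: f0; apply/funext => z.
  by apply: contrapT => fz; apply: nex; exists z.
by exists (src z), f, z.
Qed.

(** Right multiplication by the indicator of a bisection around [x] carries the value at [z] to the
    product of [z] and [x]. *)
Lemma support_units_invariant I x : two_sided_ideal conv A I ->
  support_units I (rng x) -> support_units I (src x).
Proof.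
move=> [_ _ _ IM] [f [z [If zx fz]]].
have [B [[oB cB] Bx _ injB _]] :=
  ample_bisection_basis aG openT (Logic.I : setT x).
have Ae : A (indic_scale 1 B) by exact: indic_scale_steinberg.
have zxP : gcomp (z, x) by rewrite gcompP.
exists (conv f (indic_scale 1 B)), (gmul z x); split.
- exact: (IM _ _ Ae If).2.
- exact: srcM.
- by rewrite (convolution_indicr _ _ injB Bx) ?srcM// mulr1 gmulgK.
Qed.

End SupportUnits.

(** * From isotropy group algebras to the Steinberg algebra *)

Theorem theorem4p4 (G : topologicalGroupoidType) (R : comPzRingType)
    (ampleG : ample G) (hausdorffG : hausdorff_space G) :
  (topologically_transitive G ->
   (exists D : set (unit_space G), dense D /\
      forall d, D d ->
        prime_ring (@group_algebra_mul R (isotropy_group d))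
                   (@group_algebra R (isotropy_group d))) ->
   prime_ring (@convolution R G) (@steinberg_algebra R G))
  /\
  ((exists D : set (unit_space G), dense D /\
      forall d, D d ->
        semiprime_ring (@group_algebra_mul R (isotropy_group d))
                       (@group_algebra R (isotropy_group d))) ->
   semiprime_ring (@convolution R G) (@steinberg_algebra R G)).
Proof.
split=> [ttG [D [dD primeD]] I J idI idJ IJ|[D [dD semiprimeD]] I idI II].
- apply: contrapT => /not_orP[nI nJ].
  have [IA I0 _ _] := idI; have [JA J0 _ _] := idJ.
  have oI := support_units_open ampleG IA.
  have oJ := support_units_open ampleG JA.
  (* Transitivity gives an arrow from the units of [J] to those of [I]; by invariance its source
     belongs to both sets, and density then puts a point of [D] in their open intersection. *)
  have [x [/= xI xJ]] := ttG _ _ oI oJ (support_units_neq0 I0 nI)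
    (support_units_neq0 J0 nJ).
  have xI' := support_units_invariant ampleG hausdorffG idI xI.
  have [|u [[[f [z [If zu fz]]] [g [w [Jg wu gw]]]] Du]] :=
    dD (support_units I `&` support_units J) _ (openI oI oJ).
    by exists (src x).
  have := isotropy_res_ideal_mul ampleG hausdorffG u idI idJ IJ.
  case/(primeD u Du); [exact: isotropy_res_ideal|exact: isotropy_res_ideal| |].
  + exact: isotropy_res_ideal_neq0 idI If zu fz.
  + exact: isotropy_res_ideal_neq0 idJ Jg wu gw.
- apply: contrapT => nI; have [IA I0 _ _] := idI.
  (* For a single ideal, density applies directly to its own nonempty open set of units. *)
  have [u [[f [z [If zu fz]]] Du]] :=
    dD _ (support_units_neq0 I0 nI) (support_units_open ampleG IA).
  have := isotropy_res_ideal_mul ampleG hausdorffG u idI idI II.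
  move/(semiprimeD u Du _ (isotropy_res_ideal ampleG hausdorffG u idI)).
  exact: isotropy_res_ideal_neq0 idI If zu fz.
Qed.
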